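(* Let $k$ and $m\geq 2$ be positive integers, let $n_1,\dots,n_m$ be positive integers and $n=n_1+\cdots+n_m$, and assume $k$ divides $n$. Let $\sigma\in\mathrm{SIM}(X)$ have disjoint path and cycle decomposition \[\sigma=\sigma_{11}\cdots\sigma_{1n_1}\,\sigma_{21}\cdots\sigma_{2n_2}\cdots\sigma_{m1}\cdots\sigma_{mn_m}\] consisting only of paths (no cycles), where for some integer $L$ every path $\sigma_{ij}$ has length $\ell(\sigma_{ij})=L-(i-1)$, and $\ell(\sigma_{ij})\geq 2$ for all $i,j$. Then \[ r_k(\sigma)=\sum_{\lambda_1,\dots,\lambda_{m-1}}\frac{n_1!\,n_2!\cdots n_m!}{\left(n/k-\sum_{i=1}^{m-1}\ell(\lambda_i)\right)!\ \prod_{i=1}^{m-1}\prod_{a\in\lambda_i}\mathrm{freq}(a,\lambda_i)!}, \] where the sum is over all tuples of integer partitions $\lambda_1,\dots,\lambda_{m-1}$ such that $\lambda_1\vdash n_1$, $\lambda_2\vdash n_1+n_2-k\ell(\lambda_1)$, and in general $\lambda_j\vdash \sum_{i=1}^{j}n_i-k\sum_{i=1}^{j-1}\ell(\lambda_i)$ for $1\le j\le m-1$, with $\max\lambda_i\leq k$ and $\ell(\lambda_i)\leq (n_{i+1}+\sum\lambda_i)/k$ for all $1\le i\le m-1$. Some of the $\lambda_i$ may be the (empty) partition of zero.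
   Context: For a finite set $X$, $\mathrm{SIM}(X)$ is the symmetric inverse monoid: the set of all partial one-to-one maps from $X$ to itself, under composition. For distinct $a_1,\dots,a_\ell$, the path $[a_1a_2\cdots a_\ell]$ is the partial map sending $a_i\mapsto a_{i+1}$ for $i<\ell$ and undefined at $a_\ell$ (so $[a]$ is the nowhere-defined map on $\{a\}$); the cycle $(a_1\cdots a_\ell)$ sends $a_i\mapsto a_{i+1}$ for $i<\ell$ and $a_\ell\mapsto a_1$. Its length is $\ell$ and $a_1,\dots,a_\ell$ are its digits. Paths/cycles are disjoint if their digit sets are disjoint, and a product of disjoint paths/cycles is the partial map on the union of their digits agreeing with each one on its digits. Every element of $\mathrm{SIM}(X)$ is uniquely a product of disjoint paths and cycles whose digit sets partition $X$ (its disjoint path and cycle decomposition, length-one paths and cycles included). For a positive integer $k$, a $k$th root of $\sigma\in\mathrm{SIM}(X)$ is an $\alpha\in\mathrm{SIM}(X)$ with $\alpha^k=\sigma$, and $r_k(\sigma)$ denotes the number of $k$th roots of $\sigma$. For an integer partition $\lambda: a_1+\cdots+a_t=N$ of $N$ into positive parts we write $\lambda\vdash N$, $\ell(\lambda)=t$ (number of parts), $\max\lambda=\max_i a_i$, $\sum\lambda=N$, and $\mathrm{freq}(a,\lambda)$ is the number of indices $i$ with $a_i=a$; $\prod_{a\in\lambda}$ ranges over the distinct values occurring among the parts. The partition of zero is the empty partition, with length $0$. *)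

(* Defs.v *)
From HB Require Import structures.
From mathcomp Require Import all_boot all_order all_algebra.

Set Implicit Arguments.
Unset Strict Implicit.
Unset Printing Implicit Defensive.

Import Order.TTheory GRing.Theory Num.Theory.
Local Open Scope ring_scope.

Section SymmetricInverseMonoid.
Variable X : finType.

(* A partial map from X to X is an f : {ffun X -> option X}, with domain the
   x such that f x is a Some (through the coercion isSome : option >-> bool). *)
Definition partial_injective (f : {ffun X -> option X}) : bool :=
  dinjectiveb f [pred x | f x].

Record SIM := MkSIM {
  SIM_fun :> {ffun X -> option X};
  SIM_inj : partial_injective SIM_fun
}.

HB.instance Definition _ := [isSub for SIM_fun].
HB.instance Definition _ := [Finite of SIM by <:].

Lemma partial_injectiveP (f : {ffun X -> option X}) :
  reflect (forall x y z, f x = Some z -> f y = Some z -> x = y)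
          (partial_injective f).
Proof.
apply: (iffP (dinjectiveP _ _)) => inj_f.
  by move=> x y z fx fy; apply: inj_f; rewrite ?inE ?fx ?fy.
by move=> x y; rewrite !inE; case fx: (f x) => [z|] // _ _ /esym; apply: inj_f.
Qed.

Lemma SIMP (f g : SIM) : f =1 g -> f = g.
Proof. by move=> eq_fg; apply/val_inj/ffunP. Qed.

Lemma SIM1_subproof : partial_injective [ffun x => Some x].
Proof. by apply/partial_injectiveP => x y z; rewrite !ffunE => -[->] [->]. Qed.

Definition SIM1 : SIM := MkSIM SIM1_subproof.

Lemma SIM_mul_subproof (f g : SIM) :
  partial_injective [ffun x => obind g (f x)].
Proof.
apply/partial_injectiveP => x y z; rewrite !ffunE.
case fx: (f x) => [x'|] //=; case fy: (f y) => [y'|] //= gx gy.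
have eq_xy' := partial_injectiveP _ (SIM_inj g) _ _ _ gx gy.
by rewrite eq_xy' in fx; apply: (partial_injectiveP _ (SIM_inj f)) fx fy.
Qed.

(* Composition from left to right: first f, then g. *)
Definition SIM_mul (f g : SIM) : SIM := MkSIM (SIM_mul_subproof f g).

Lemma SIM_mulA : associative SIM_mul.
Proof.
move=> f g h; apply: SIMP => x; rewrite !ffunE.
by case: (f x) => //= y; rewrite ffunE.
Qed.

Lemma SIM_mul1 : left_id SIM1 SIM_mul.
Proof. by move=> f; apply: SIMP => x; rewrite !ffunE. Qed.

Lemma SIM_mulr1 : right_id SIM1 SIM_mul.
Proof.
move=> f; apply: SIMP => x; rewrite !ffunE.
by case: (f x) => //= y; rewrite ffunE.
Qed.

HB.instance Definition _ :=
  isMonoid.Build SIM SIM_mulA SIM_mul1 SIM_mulr1.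

Definition root_count (k : nat) (s : SIM) : nat :=
  #|[set a : SIM | (a ^+ k)%g == s]|.

Inductive component := Path of seq X | Cycle of seq X.

Definition component_code (c : component) : seq X + seq X :=
  match c with Path s => inl s | Cycle s => inr s end.

Definition component_decode (t : seq X + seq X) : component :=
  match t with inl s => Path s | inr s => Cycle s end.

Lemma component_codeK : cancel component_code component_decode.
Proof. by case. Qed.

HB.instance Definition _ :=
  Equality.copy component (can_type component_codeK).

Definition digits (c : component) : seq X :=
  match c with Path s => s | Cycle s => s end.

(* On its digits a path maps each one to the next and is undefined at the last
   one; [onth] returns None past the end of the sequence. *)
Definition component_fun (c : component) (x : X) : option X :=
  match c with
  | Path s => onth s (index x s).+1
  | Cycle s => if x \in s then Some (next s x) else None
  end.

(* The components in cs are nonempty, and every element of X is exactly once a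
   digit of a component: the digits of each component are distinct and the
   digit sets partition X. *)
Definition decomposition (s : SIM) (cs : seq component) : Prop :=
  [/\ all (fun c => 0 < size (digits c))%N cs,
      perm_eq (flatten [seq digits c | c <- cs]) (enum X) &
      forall c x, c \in cs -> x \in digits c -> s x = component_fun c x].

End SymmetricInverseMonoid.

Arguments Path {X} _.
Arguments Cycle {X} _.

Section IntegerPartitions.

Definition is_intpart (p : seq nat) : bool :=
  sorted geq p && (0%N \notin p).

(* Integer partitions, as nonincreasing sequences of positive parts, of the
   integers not exceeding B; there are finitely many of them. *)
Record intpart_upto (B : nat) := MkIntpart {
  parts :> seq nat;
  partsP : is_intpart parts && (sumn parts <= B)%N
}.

Variable B : nat.

HB.instance Definition _ := [isSub for @parts B].
HB.instance Definition _ := [Countable of intpart_upto B by <:].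

Lemma size_intpart_upto (p : intpart_upto B) : (size p <= B)%N.
Proof.
case: p => p /= /andP[/andP[_ p0] leB]; apply: leq_trans leB.
elim: p p0 => //= a p IHp; rewrite inE negb_or eq_sym -lt0n => /andP[a0 p0].
by rewrite -add1n leq_add ?IHp.
Qed.

Lemma ltn_intpart_upto (p : intpart_upto B) a : a \in parts p -> (a < B.+1)%N.
Proof.
case: p => p /= /andP[_ leB] ap; rewrite ltnS; apply: leq_trans leB.
by rewrite (perm_sumn (perm_to_rem ap)) leq_addr.
Qed.

Definition intpart_code (p : intpart_upto B) : B.-bseq 'I_B.+1 :=
  insub_bseq B [seq inord a | a <- p].

Definition intpart_decode (b : B.-bseq 'I_B.+1) : option (intpart_upto B) :=
  insub [seq val i | i <- b].

Lemma intpart_codeK : pcancel intpart_code intpart_decode.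
Proof.
move=> p; rewrite /intpart_decode /intpart_code insubdK; last first.
  by rewrite unfold_in size_map size_intpart_upto.
rewrite -map_comp (_ : map _ _ = val p) ?valK //.
by apply: map_id_in => a /ltn_intpart_upto ltaB; rewrite /= inordK.
Qed.

HB.instance Definition _ : isFinite (intpart_upto B) :=
  PCanIsFinite intpart_codeK.

End IntegerPartitions.

Definition freq (a : nat) (p : seq nat) : nat := count_mem a p.

Section RootFormula.
Variables (k m : nat) (n : nat -> nat).

Let N := (\sum_(i < m) n i)%N.

(* The indices are shifted by one: n i and lam i stand for n_(i+1) and
   lambda_(i+1). Since lam j is to be a partition of an integer at most
   n_1 + ... + n_(j+1), taking it in intpart_upto N excludes nothing. The sum
   and quotient conditions are stated in int and rat to avoid truncation. *)
Definition admissible (lam : {ffun 'I_m.-1 -> intpart_upto N}) : bool :=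
  [forall j : 'I_m.-1,
    [&& (sumn (lam j))%:Z ==
          \sum_(i < m | (i <= j)%N) (n i)%:Z
          - k%:Z * \sum_(i < m.-1 | (i < j)%N) (size (lam i))%:Z,
        (\max_(a <- lam j) a <= k)%N &
        (size (lam j))%:R <= (n j.+1 + sumn (lam j))%N%:R / k%:R :> rat]].

(* For admissible lam the last quotient condition gives
   \sum_i size (lam i) <= N %/ k, so the subtraction does not truncate. *)
Definition root_term (lam : {ffun 'I_m.-1 -> intpart_upto N}) : rat :=
  (\prod_(i < m) (n i)`!)%N%:R /
  ((N %/ k - \sum_(i < m.-1) size (lam i))`! *
   \prod_(i < m.-1) \prod_(a <- undup (lam i)) (freq a (lam i))`!)%N%:R.

End RootFormula.

(* Main.v *)
Require Import Defs.
From mathcomp Require Import all_boot all_order all_algebra all_fingroup.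

Set Implicit Arguments.
Unset Strict Implicit.
Unset Printing Implicit Defensive.

(** A k-th root of sigma consists of paths only, and the k-th power of a path of
    length y * k + r is the product of r paths of length y.+1 and k - r paths of
    length y, interleaved. Hence a root amounts to an unordered family of
    q = N / k ordered rows of k paths of sigma, the lengths in a row being
    nonincreasing and differing by at most one. Ordering the rows multiplies the
    count by q!, and the resulting q x k tableaux are counted through the
    classes of their entries: a class pattern with the right content is realized by
    n_1! ... n_m! tableaux. A row of a pattern is described by the class i of
    its first entry and the number a of entries of that class, and the numbers a for
    the rows starting in class i form the partition lambda_i; multinomial
    counting of the patterns with given partitions gives the formula. *)

(** * Colour-preserving bijections between coloured finite sets *)

Section ColoredBijections.
Variables (A B T : finType).

Definition fiber (U : finType) (c : U -> T) (t : T) : {set U} :=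
  [set x | c x == t].

Lemma sum_fiber (U : finType) (c : U -> T) : \sum_t #|fiber c t| = #|U|.
Proof.
rewrite -sum1_card (partition_big c predT) //=.
by apply: eq_bigr => t _; rewrite -sum1_card; apply: eq_bigl => x; rewrite inE.
Qed.

(** Induction on [r], the colours whose points may be moved: a permutation for [t :: r] factors
    uniquely as one supported on the fiber of [t] times one for [r]. *)
Lemma card_colored_perm_seq (c : A -> T) (r : seq T) : uniq r ->
  #|[set p : {perm A} |
      [forall x, (c (p x) == c x) && ((c x \in r) || (p x == x))]]|
  = \prod_(t <- r) #|fiber c t|`!.
Proof.
elim: r => [_|t r IH /= /andP[tr ur]].
  rewrite big_nil -(cards1 (1%g : {perm A})); congr #|pred_of_set _|.
  apply/setP => p; rewrite !inE; apply/forallP/eqP => [h|-> x].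
    by apply/permP => x; rewrite perm1; have /andP[_ /eqP] := h x.
  by rewrite perm1 !eqxx.
rewrite big_cons -(IH ur) -(card_perm (fiber c t)).
rewrite -(cardsE (perm_on (fiber c t))) -cardsX.
set G1 := [set p in _]; set G2 := [set p | _].
rewrite -(@card_in_imset _ _ (fun pp : {perm A} * {perm A} => (pp.1 * pp.2)%g)).
  congr #|pred_of_set _|; apply/setP => p; rewrite inE.
  apply/forallP/imsetP => [h|[[p1 p2]]]; last first.
    rewrite inE /= !inE => /andP[on1 /forallP h2] -> x /=; rewrite permM.
    have [xt|xt] := boolP (x \in fiber c t).
      have := xt; rewrite inE => /eqP ->.
      have p1x : p1 x \in fiber c t by rewrite (perm_closed _ on1).
      have /andP[/eqP -> _] := h2 (p1 x).
      by have := p1x; rewrite inE => /eqP ->; rewrite inE !eqxx.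
    rewrite (out_perm on1 xt) inE; have /andP[-> /= /orP[->|->]] := h2 x.
      by rewrite orbT.
    by rewrite !orbT.
  have pN : p \in 'N(fiber c t | 'P)%g.
    by apply/astabsP => x; rewrite /= /aperm !inE; have /andP[/eqP -> _] := h x.
  exists (restr_perm (fiber c t) p, (restr_perm (fiber c t) p)^-1 * p)%g;
    last by rewrite /= mulKVg.
  apply/setXP; split; rewrite inE; first exact: restr_perm_on.
  apply/forallP => x.
  set r1 := restr_perm _ _; rewrite permM.
  have on1 : perm_on (fiber c t) r1 by exact: restr_perm_on.
  have [xt|xt] := boolP (x \in fiber c t).
    have /esym yt : (x \in fiber c t) = ((r1^-1)%g x \in fiber c t).
      by rewrite -{1}(permKV r1 x) perm_closed.
    rewrite -(restr_permE pN) ?yt // permKV !eqxx /=.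
    by rewrite orbT.
  have -> : (r1^-1)%g x = x.
    by apply: (canLR (permK r1)); rewrite (out_perm on1 xt).
  have /andP[-> /=] := h x; rewrite inE.
  by move: xt; rewrite inE => /negPf ->.
move=> [p1 p2] [q1 q2] /setXP[/= on1 +] /setXP[/= on1' +] e.
rewrite /G2 !inE => /forallP h2 /forallP h2'; rewrite !inE in on1 on1'.
(* Since [t] is not in [r], the second factor fixes the fiber of [t] pointwise, so the product
   determines the first factor. *)
have fix2 (r1 r2 : {perm A}) x : perm_on (fiber c t) r1 ->
    (forall x, (c (r2 x) == c x) && ((c x \in r) || (r2 x == x))) ->
    x \in fiber c t -> (r1 * r2)%g x = r1 x.
  move=> on hr xt; rewrite permM.
  have : r1 x \in fiber c t by rewrite (perm_closed _ on).
  rewrite inE => /eqP ct; have /andP[_] := hr (r1 x).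
  by rewrite ct (negPf tr) /= => /eqP.
have e1 : p1 = q1.
  apply/permP => x; have [xt|xt] := boolP (x \in fiber c t).
    by rewrite -(fix2 p1 p2) // e fix2.
  by rewrite (out_perm on1 xt) (out_perm on1' xt).
by rewrite e1 in e *; rewrite (mulgI _ _ _ e).
Qed.

Lemma card_colored_perm (c : A -> T) :
  #|[set p : {perm A} | [forall x, c (p x) == c x]]| = \prod_t #|fiber c t|`!.
Proof.
rewrite -big_enum -card_colored_perm_seq ?enum_uniq //.
congr #|pred_of_set _|; apply/setP => p; rewrite !inE.
by apply: eq_forallb => x; rewrite mem_enum andbT.
Qed.

(** Points of equal rank in the enumerations of corresponding fibers are matched. *)
Lemma colored_bijection_exists (c : A -> T) (d : B -> T) :
    (forall t, #|fiber c t| = #|fiber d t|) ->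
  exists2 f : A -> B, injective f & forall x, d (f x) = c x.
Proof.
move=> eqf.
have idx x : index x (enum (fiber c (c x))) < #|fiber d (c x)|.
  by rewrite -eqf cardE index_mem mem_enum inE.
pose f x := enum_val (Ordinal (idx x)).
have df x : d (f x) = c x by have := enum_valP (Ordinal (idx x)); rewrite inE => /eqP.
exists f => // x y fxy.
have cxy : c x = c y by rewrite -!df fxy.
have ex z : f z = nth (f z) (enum (fiber d (c z))) (index z (enum (fiber c (c z)))).
  by rewrite {1}/f (enum_val_nth (f z)).
have := ex x; rewrite {1 2}fxy cxy {1}(ex y) => /eqP; rewrite nth_uniq ?enum_uniq //.
- move/eqP/(congr1 (nth x (enum (fiber c (c y))))).
  by rewrite !nth_index ?mem_enum ?inE ?cxy.
- by rewrite -cardE.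
by rewrite -cardE -cxy.
Qed.

Definition colored_injections (c : A -> T) (d : B -> T) :=
  [set f : {ffun A -> B} | injectiveb f && [forall x, d (f x) == c x]].

(** Composition with one colour-preserving bijection [g] reduces the count to colour-preserving
    permutations of [A]. *)
Lemma card_colored_injections (c : A -> T) (d : B -> T) :
    (forall t, #|fiber c t| = #|fiber d t|) ->
  #|colored_injections c d| = \prod_t #|fiber c t|`!.
Proof.
move=> eqf; have [g gI dg] := colored_bijection_exists eqf.
have cAB : #|A| = #|B|.
  by rewrite -(sum_fiber c) -(sum_fiber d); apply: eq_bigr => t _; apply: eqf.
have gB : bijective g by apply: inj_card_bij => //; rewrite cAB.
have [h gK hK] := gB.
rewrite -card_colored_perm.
rewrite -(@card_in_imset _ _ (fun p : {perm A} => [ffun x => g (p x)])).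
  congr #|pred_of_set _|; apply/setP => f; rewrite inE.
  apply/andP/imsetP => [[/injectiveP fI /forallP df]|[p]].
    have hfI : injective (h \o f) by apply: inj_comp fI; apply: can_inj hK.
    exists (perm hfI); last by apply/ffunP => x; rewrite ffunE permE /= hK.
    by rewrite inE; apply/forallP => x; rewrite permE /= -dg hK.
  rewrite inE => /forallP hp ->; split.
    by apply/injectiveP => x y; rewrite !ffunE => /gI /perm_inj.
  by apply/forallP => x; rewrite ffunE dg.
move=> p1 p2 _ _ /ffunP e; apply/permP => x; apply: gI.
by have := e x; rewrite !ffunE.
Qed.

Lemma fiber_colored_injection (c : A -> T) (d : B -> T) f : #|A| = #|B| ->
  f \in colored_injections c d -> forall t, #|fiber c t| = #|fiber d t|.
Proof.
rewrite inE => cAB /andP[/injectiveP fI /forallP df] t.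
have fB : bijective f by apply: inj_card_bij => //; rewrite cAB.
rewrite -(card_imset _ fI); congr #|pred_of_set _|; apply/setP => y.
case: fB => g fK gK.
by rewrite -[y]gK (mem_imset _ _ fI) !inE (eqP (df _)).
Qed.

End ColoredBijections.

(** * Multinomial counting of words with prescribed letter multiplicities *)

Section Multinomial.
Variable (T : finType).

Lemma fiber_sizes_exist (mu : T -> nat) q : \sum_t mu t = q ->
  exists t : {ffun 'I_q -> T}, forall y, #|fiber t y| = mu y.
Proof.
move=> smu; pose s := flatten [seq nseq (mu t) t | t <- enum T].
have sz : size s = q.
  rewrite size_flatten sumnE big_map big_map big_enum -smu.
  by apply: eq_bigr => t _; rewrite size_nseq.
exists [ffun i => tnth (Tuple (introT eqP sz)) i] => y.
transitivity (count_mem y s).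
  rewrite -[s]/(tval (Tuple (introT eqP sz))).
  rewrite -[tval _ in RHS]map_tnth_enum count_map.
  rewrite cardE size_filter -enumT.
  by apply: eq_in_count => i _; rewrite /= !inE ffunE.
rewrite count_flatten -map_comp sumnE big_map big_enum (bigD1 y) //=.
rewrite count_nseq /= eqxx mul1n big1 ?addn0 // => t ty.
by rewrite count_nseq /= (negPf ty).
Qed.

(** The [q!] permutations of the positions are grouped by the rearrangement of a fixed word [t0]
    that they produce; the permutations producing a given word are colour-preserving injections. *)
Lemma card_fiber_sizes (mu : T -> nat) q : \sum_t mu t = q ->
  #|[set t : {ffun 'I_q -> T} | [forall y, #|fiber t y| == mu y]]|
    * \prod_y (mu y)`! = q`!.
Proof.
move=> smu; have [t0 t0P] := fiber_sizes_exist smu.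
set F := [set t | _].
transitivity #|[set f : {ffun 'I_q -> 'I_q} | injectiveb f]|; last first.
  by rewrite card_inj_ffuns !card_ord ffactnn.
rewrite -[RHS]sum1_card.
rewrite (partition_big (fun f : {ffun 'I_q -> 'I_q} => [ffun b => t0 (f b)])
                       (fun t => t \in F)).
  rewrite -sum_nat_const; apply: eq_bigr => t; rewrite inE => /forallP tF.
  transitivity #|colored_injections t t0|.
    rewrite card_colored_injections => [|y]; last by rewrite (eqP (tF y)) t0P.
    by apply: eq_bigr => y _; rewrite (eqP (tF y)).
  rewrite -sum1_card; apply: eq_bigl => f; rewrite !inE; congr (_ && _).
  apply/forallP/eqP => [e|e x]; first by apply/ffunP=> b; rewrite ffunE (eqP (e b)).
  by rewrite -e ffunE.
move=> f; rewrite inE => fI; rewrite inE; apply/forallP => y; rewrite -t0P.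
apply/eqP; apply: (@fiber_colored_injection _ _ _ _ _ f) => //.
by rewrite inE fI; apply/forallP => x; rewrite ffunE.
Qed.

End Multinomial.

(** * Powers of a partial injective map *)

Section PowersInSIM.
Variable X : finType.
Implicit Types (a : SIM X) (x y : X).

Lemma SIM_expD a u v x :
  (a ^+ (u + v))%g x = obind (a ^+ v)%g ((a ^+ u)%g x).
Proof. by rewrite expgnDr ffunE. Qed.

Lemma SIM_exp0 a x : (a ^+ 0)%g x = Some x.
Proof. by rewrite expg0 ffunE. Qed.

Lemma SIM_expS a u x : (a ^+ u.+1)%g x = obind a ((a ^+ u)%g x).
Proof. by rewrite expgSr ffunE. Qed.

Lemma SIM_injective a x y z : a x = Some z -> a y = Some z -> x = y.
Proof. exact: (partial_injectiveP _ (SIM_inj a)). Qed.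

Lemma SIM_exp_defined a u v x :
  u <= v -> (a ^+ v)%g x -> exists y, (a ^+ u)%g x = Some y.
Proof.
move=> /subnKC <-; rewrite SIM_expD.
by case: ((a ^+ u)%g x) => //= y _; exists y.
Qed.

End PowersInSIM.

(** * Roots of a product of paths, represented by tableaux *)

Section RootsOfPaths.
Variables (X P : finType) (S : P -> seq X) (sigma : SIM X) (k' q : nat).
Local Notation k := k'.+1.

Hypothesis digitsS : perm_eq (flatten [seq S p | p <- enum P]) (enum X).
Hypothesis sizeS : forall p, 1 < size (S p).
Hypothesis sigmaS : forall p x, x \in S p ->
  sigma x = onth (S p) (index x (S p)).+1.
Hypothesis cardP : #|P| = q * k.

Local Notation pt p j := (onth (S p) j).

Lemma sum_count_digits x : \sum_p count_mem x (S p) = 1.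
Proof.
rewrite -big_enum -(big_map (fun p => count_mem x (S p)) xpredT id).
rewrite -sumnE (map_comp (count_mem x) S) -count_flatten (seq.permP digitsS).
by rewrite count_uniq_mem ?enum_uniq // mem_enum.
Qed.

Lemma uniq_digits p : uniq (S p).
Proof.
apply: count_mem_uniq => x; have := sum_count_digits x.
rewrite (bigD1 p) //= -has_pred1 has_count.
by case: (count_mem x (S p)) => [|[|c]].
Qed.

Lemma pt_exists x : exists p j, pt p j = Some x.
Proof.
have : x \in flatten [seq S p | p <- enum P].
  by rewrite (perm_mem digitsS) mem_enum.
by case/flatten_mapP=> p _ /onthP[j e]; exists p, j.
Qed.

Lemma pt_inj p j p' j' x :
  pt p j = Some x -> pt p' j' = Some x -> p = p' /\ j = j'.
Proof.
move=> e e'.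
have xp : x \in S p by apply/onthP; exists j.
have xp' : x \in S p' by apply/onthP; exists j'.
have epp' : p = p'.
  apply/eqP; apply: contraT => npp'; have := sum_count_digits x.
  rewrite (bigD1 p) // (bigD1 p') 1?eq_sym //=.
  move: xp xp'; rewrite -!has_pred1 !has_count.
  by case: (count _ _) => // c _; case: (count _ _) => // c' _; rewrite !addSn addnS.
split=> //; rewrite -epp' in e'.
apply: (@onth_inj _ (S p)); rewrite ?uniq_digits ?e ?e' //.
by rewrite gtn_min -!onthTE e e'.
Qed.

Lemma pt_sigma p j x : pt p j = Some x -> sigma x = pt p j.+1.
Proof.
move=> e; have xp : x \in S p by apply/onthP; exists j.
rewrite (sigmaS xp).
have [|_ ->] := @pt_inj p (index x (S p)) p j x _ e => //.
by rewrite onthE (nth_map x) ?nth_index ?index_mem.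
Qed.

Lemma start_sig p : {x | pt p 0 = Some x}.
Proof. by case: (S p) (sizeS p) => //= x s _; exists x. Qed.

Definition start p : X := sval (start_sig p).

Lemma startE p : pt p 0 = Some (start p).
Proof. exact: svalP (start_sig p). Qed.

Lemma start_inj : injective start.
Proof.
move=> p p' e; have := startE p'; rewrite -e => e'.
by have [] := pt_inj (startE p) e'.
Qed.

Lemma sigma_start y p : sigma y <> Some (start p).
Proof.
have [p' [j e]] := pt_exists y; rewrite (pt_sigma e) => e'.
by have [] := pt_inj e' (startE p).
Qed.

(** With [sigma_start], this recognizes the first digits of paths from [sigma] alone: any later
    digit has its predecessor as a preimage. *)
Lemma start_exists x : (forall y, sigma y <> Some x) -> exists p, x = start p.
Proof.
move=> h; have [p [[|j] e]] := pt_exists x.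
  by exists p; move: e; rewrite startE => -[].
case e' : (pt p j) => [y|]; first by case: (h y); rewrite (pt_sigma e').
have : j < size (S p) by apply: ltnW; rewrite -onthTE e.
by rewrite -onthTE e'.
Qed.

Lemma sigma_exp p y : (sigma ^+ y)%g (start p) = pt p y.
Proof.
elim: y => [|y IH]; first by rewrite SIM_exp0 startE.
rewrite SIM_expS IH; case e : (pt p y) => [x|]; first exact: pt_sigma.
by apply/esym/onth_default; rewrite leqW // -onthNE e.
Qed.

Lemma root_exp (a : SIM X) y i x : (a ^+ k)%g = sigma ->
  (a ^+ (y * k + i))%g x = obind (sigma ^+ y)%g ((a ^+ i)%g x).
Proof. by move=> ak; rewrite addnC SIM_expD mulnC expgnA ak. Qed.

Local Notation tableau := {ffun 'I_q * 'I_k -> P}.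
Implicit Types (w : tableau) (b : 'I_q).

(* Row b of w lists the paths interleaved into one path of the root; this is
   the u-th digit of that path. *)
Definition pos w b u : option X := pt (w (b, inord (u %% k))) (u %/ k).

(** Only the first [k] digits of the path of each row are prescribed; the equation [a ^+ k = sigma]
    forces the later ones, see [represents_pos]. *)
Definition represents (a : SIM X) w : bool :=
  [forall b, forall i : 'I_k,
    (a ^+ i)%g (start (w (b, ord0))) == Some (start (w (b, i)))].

(** Amounts to saying that the positions where [pos w b] is defined form an initial segment of the
    natural numbers. *)
Definition balanced w : bool :=
  [forall b, forall i : 'I_k, forall j : 'I_k, (i <= j) ==>
    (size (S (w (b, j))) <= size (S (w (b, i))) <= (size (S (w (b, j)))).+1)].

Lemma represents_pos a w b u : (a ^+ k)%g = sigma -> represents a w ->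
  (a ^+ u)%g (start (w (b, ord0))) = pos w b u.
Proof.
move=> ak /forallP/(_ b)/forallP/(_ (inord (u %% k)))/eqP.
rewrite inordK ?ltn_pmod // => e.
by rewrite {1}(divn_eq u k) root_exp // e /= sigma_exp.
Qed.

Lemma posE w b y (i : 'I_k) : pos w b (y * k + i) = pt (w (b, i)) y.
Proof.
rewrite /pos modnMDl divnMDl // modn_small // divn_small // addn0.
by rewrite inord_val.
Qed.

(** By [cardP] an injective tableau is a bijection onto [P], so its rows exhaust the digits. *)
Lemma pos_exists w x : injective w -> exists b u, pos w b u = Some x.
Proof.
move=> wI; have [p [j e]] := pt_exists x.
have /codomP[[b i] ep] : p \in codom w.
  by apply: inj_card_onto => //; rewrite cardP card_prod !card_ord.
by exists b, (j * k + i); rewrite posE -ep.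
Qed.

Lemma pos_inj w b u b' u' x : injective w ->
  pos w b u = Some x -> pos w b' u' = Some x -> b = b' /\ u = u'.
Proof.
move=> wI e e'; have [/wI ebi eq] := pt_inj e e'.
have := congr1 (fun bi => nat_of_ord bi.2) ebi.
rewrite /= !inordK ?ltn_pmod // => em; split; first by case: ebi.
by rewrite (divn_eq u k) (divn_eq u' k) em eq.
Qed.

Lemma represents_unique a a' w : injective w ->
    (a ^+ k)%g = sigma -> represents a w ->
  (a' ^+ k)%g = sigma -> represents a' w -> a = a'.
Proof.
move=> wI ak ra ak' ra'; apply: SIMP => x.
have [b [u e]] := pos_exists x wI.
have h c : (c ^+ k)%g = sigma -> represents c w -> c x = pos w b u.+1.
  move=> ck rc; rewrite -(represents_pos _ _ ck rc) SIM_expS.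
  by rewrite (represents_pos _ _ ck rc) e.
by rewrite (h a) // (h a').
Qed.

(** If [v] steps of [a] can be made from a point, so can fewer; both inequalities compare the last
    digit in one column with an earlier position in another. *)
Lemma represents_balanced a w : (a ^+ k)%g = sigma -> represents a w -> balanced w.
Proof.
move=> ak ra; apply/forallP => b; apply/forallP => i; apply/forallP => j.
have down u v : u <= v -> pos w b v -> pos w b u.
  move=> uv; rewrite -!(represents_pos _ _ ak ra) => /(SIM_exp_defined uv)[y].
  by move=> ->.
apply/implyP => ij; apply/andP; split.
  case es : (size (S (w (b, j)))) => [|y] //.
  rewrite -onthTE -posE; apply: (down _ (y * k + j)); first by rewrite leq_add2l.
  by rewrite posE onthTE es.
(* With length [y.+2], column [i] has a digit at position [y.+1 * k + i], which comes after
   [y * k + j] because [j < k]. *)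
case es : (size (S (w (b, i)))) => [|[|y]] //.
rewrite ltnS -onthTE -posE; apply: (down _ (y.+1 * k + i)).
  by rewrite mulSn -addnA addnCA leq_add2l (leq_trans (ltnW (ltn_ord j))) // leq_addr.
by rewrite posE onthTE es.
Qed.

Lemma balanced_pos w b u : balanced w -> pos w b u.+1 -> pos w b u.
Proof.
move=> /forallP/(_ b)/forallP bw; rewrite /pos modnS divnS //.
have um : u %% k < k by rewrite ltn_pmod.
(* If [k] divides [u.+1], position [u.+1] is back in column 0, one digit further along its path;
   otherwise it is in the next column, at the same digit index. *)
case: ifP => ku; rewrite !onthTE.
  have /forallP/(_ (inord (u %% k))) := bw (inord 0).
  rewrite !inordK //= => /andP[_ le2].
  by rewrite add1n => /leq_trans-/(_ _ le2).
have um' : (u %% k).+1 < k.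
  rewrite ltn_neqAle um andbT; apply: contraFN ku => /eqP e.
  by rewrite {1}(divn_eq u k) -addnS e dvdn_add ?dvdn_mull.
have /forallP/(_ (inord (u %% k).+1)) := bw (inord (u %% k)).
rewrite !inordK // leqnSn /= => /andP[le1 _].
by rewrite add0n => /leq_trans; apply.
Qed.

(** The root moves each digit of a row to the digit at the next position of that row. *)
Lemma balanced_represents w : injective w -> balanced w ->
  exists2 a : SIM X, (a ^+ k)%g = sigma & represents a w.
Proof.
move=> wI bw.
have ex x : exists bu : 'I_q * nat, pos w bu.1 bu.2 == Some x.
  by have [b [u e]] := pos_exists x wI; exists (b, u); rewrite e.
(* The position chosen for [x] is unique by [pos_inj], so [fE] holds for any position of [x]. *)
pose f := [ffun x => pos w (xchoose (ex x)).1 (xchoose (ex x)).2.+1].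
have fE b u x : pos w b u = Some x -> f x = pos w b u.+1.
  move=> e; rewrite ffunE; have /eqP e' := xchooseP (ex x).
  by have [-> ->] := pos_inj wI e' e.
have fI : partial_injective f.
  apply/partial_injectiveP => x y z.
  have [b [u e]] := pos_exists x wI; have [b' [u' e']] := pos_exists y wI.
  rewrite (fE _ _ _ e) (fE _ _ _ e') => fx fy.
  have [eb [eu]] := pos_inj wI fx fy.
  by apply: Some_inj; rewrite -e -e' eb eu.
pose a := MkSIM fI.
have aE b u x v : pos w b u = Some x -> (a ^+ v)%g x = pos w b (u + v).
  move=> e; elim: v => [|v IH]; first by rewrite SIM_exp0 addn0.
  rewrite SIM_expS IH addnS; case e' : (pos w b (u + v)) => [y|] /=.
    exact: fE.
  (* Balance excludes a gap: once [pos w b] is undefined, it remains so. *)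
  case e'' : (pos _ _ _) => //.
  by have := balanced_pos (b := b) (u := u + v) bw; rewrite e' e'' => /(_ isT).
exists a.
  apply: SIMP => x; have [b [u e]] := pos_exists x wI.
  rewrite (aE _ _ _ _ e) (pt_sigma e) /pos modnDr divnDr ?dvdnn //.
  by rewrite divnn addn1.
apply/forallP => b; apply/forallP => i.
have e0 : pos w b 0 = Some (start (w (b, ord0))).
  by rewrite -[0]/(0 * k + (ord0 : 'I_k)) posE startE.
by rewrite (aE _ _ _ _ e0) -[_ + _]/(0 * k + i) posE startE.
Qed.

Lemma card_represented w : injective w ->
  #|[set a : SIM X | ((a ^+ k)%g == sigma) && represents a w]| = balanced w.
Proof.
move=> wI; case: (boolP (balanced w)) => bw.
  have [a ak ra] := balanced_represents wI bw.
  apply/eqP/cards1P; exists a; apply/setP => a'; rewrite !inE.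
  apply/andP/eqP => [[/eqP ak' ra']|->]; last by rewrite ak eqxx ra.
  exact: (represents_unique wI).
apply/eqP; rewrite cards_eq0; apply/eqP/setP => a; rewrite !inE.
by apply: contraNF bw => /andP[/eqP ak ra]; exact: represents_balanced ra.
Qed.

(** * The tableaux representing one fixed root *)

Section FixedRoot.
Variable a : SIM X.
Hypothesis ak : (a ^+ k)%g = sigma.

(** These are the paths of [sigma] whose first digit begins a path of the root [a]; they fill the
    first column of any tableau representing [a]. *)
Definition leaders : {set P} := [set p | [forall y, a y != Some (start p)]].

Lemma leader_exp p i x : p \in leaders -> (a ^+ i)%g x = Some (start p) -> i = 0.
Proof.
rewrite inE => /forallP h; case: i => // i; rewrite SIM_expS.
by case: ((a ^+ i)%g x) => //= y e; have := h y; rewrite e eqxx.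
Qed.

(** Since the path [p] has two digits, [a ^+ k] and hence [a ^+ i] is defined at [start p]. The
    point reached is not in the image of [sigma]: cancelling [i] steps would put [start p] in the
    image of [a ^+ (k - i)]. *)
Lemma leader_step_exists p i : p \in leaders -> i < k ->
  exists p', (a ^+ i)%g (start p) = Some (start p').
Proof.
move=> pR ik.
have [x e] : exists x, (a ^+ i)%g (start p) = Some x.
  apply: (SIM_exp_defined (ltnW ik)); rewrite ak.
  by rewrite -[sigma]expg1 sigma_exp onthTE.
suff [p' ex] : exists p', x = start p' by exists p'; rewrite e ex.
apply: start_exists => y; rewrite -ak => ay.
have ik' : 0 < k - i by rewrite subn_gt0.
move: ay; rewrite -(subnK (ltnW ik)) SIM_expD.
case e' : ((a ^+ (k - i))%g y) => [z|] //= az.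
have ez := SIM_injective az e; rewrite ez in e'.
by rewrite (leader_exp pR e') in ik'.
Qed.

Definition leader_step p i : P :=
  odflt p [pick p' | (a ^+ i)%g (start p) == Some (start p')].

Lemma leader_stepE p i : p \in leaders -> i < k ->
  (a ^+ i)%g (start p) = Some (start (leader_step p i)).
Proof.
move=> pR ik; rewrite /leader_step; case: pickP => [p' /eqP //|h].
by have [p' /eqP] := leader_step_exists pR ik; rewrite h.
Qed.

Lemma leader_step0 p : p \in leaders -> leader_step p 0 = p.
Proof.
by move=> pR; have := leader_stepE pR (ltn0Sn _); rewrite SIM_exp0 => -[/start_inj].
Qed.

Lemma leader_step_inj p i p' i' : p \in leaders -> p' \in leaders ->
  i < k -> i' < k -> leader_step p i = leader_step p' i' -> p = p' /\ i = i'.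
Proof.
wlog ii' : p i p' i' / i <= i' => [h pR pR' ik ik' e|].
  have [le|/ltnW le] := leqP i i'; first exact: h.
  by have [] := h _ _ _ _ le pR' pR ik' ik (esym e).
move=> pR pR' ik ik' e; have := leader_stepE pR' ik'.
rewrite -e -(subnK ii') SIM_expD; case e' : ((a ^+ (i' - i))%g _) => [z|] //= az.
have ez := SIM_injective az (leader_stepE pR ik); rewrite ez in e'.
have i0 := leader_exp pR e'; move: e'; rewrite i0 SIM_exp0 => -[/start_inj ->].
by split=> //; apply/eqP; rewrite eqn_leq ii' /= -subn_eq0 i0.
Qed.

(** Walk back along [a] from [start p] as far as possible. This takes fewer than [k] steps, since
    [k] steps would give a preimage under [sigma]; the point reached has no preimage under [a], so
    it is the start of a leader. *)
Lemma leader_step_onto p :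
  exists2 p', p' \in leaders & exists2 i, i < k & p = leader_step p' i.
Proof.
pose Q i := [exists y, (a ^+ i)%g y == Some (start p)].
have exQ : exists i, Q i.
  by exists 0; apply/existsP; exists (start p); rewrite SIM_exp0.
have bQ i : Q i -> i <= k'.
  case/existsP => y /eqP e; rewrite -ltnS ltnNge; apply/negP => ki.
  move: e; rewrite -(subnK ki) SIM_expD; case: ((a ^+ (i - k))%g y) => //= z.
  by rewrite ak => /sigma_start.
case: (ex_maxnP exQ bQ) => i Qi maxi.
have ik : i < k by rewrite ltnS bQ.
case/existsP: Qi => y /eqP ey.
have ny z : a z <> Some y.
  move=> az; suff /maxi : Q i.+1 by rewrite ltnn.
  by apply/existsP; exists z; rewrite -addn1 addnC SIM_expD expg1 az /= ey.
have [p' ep'] : exists p', y = start p'.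
  apply: start_exists => z; rewrite -ak SIM_expS.
  by case: ((a ^+ k')%g z) => //= z'; apply: ny.
have p'R : p' \in leaders.
  by rewrite inE; apply/forallP => z; apply/eqP; rewrite -ep'; apply: ny.
exists p' => //; exists i => //; apply: start_inj.
by apply: Some_inj; rewrite -leader_stepE // -ep' ey.
Qed.

(** [leader_step] is a bijection from pairs of a leader and a column onto [P], which has [q * k]
    elements. *)
Lemma card_leaders : #|leaders| = q.
Proof.
apply/eqP; rewrite -(@eqn_pmul2r k) // -cardP.
rewrite -{1}(card_ord k) -(cardsT 'I_k) -cardsX -(cardsT P).
pose f (pi : P * 'I_k) := leader_step pi.1 pi.2.
rewrite -(@card_in_imset _ _ f) => [|[p i] [p' i'] /setXP[/= pR _] /setXP[/= pR' _] e].
  apply/eqP; congr #|pred_of_set _|; apply/setP => p; rewrite inE.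
  have [p' pR' [i ik ->]] := leader_step_onto p.
  by apply/imsetP; exists (p', Ordinal ik) => //; rewrite in_setX pR' inE.
by have [-> /val_inj ->] := leader_step_inj pR pR' (ltn_ord i) (ltn_ord i') e.
Qed.

(** The first column determines the tableau, and it can be any ordering of the [q] leaders. *)
Lemma card_representing : #|[set w : tableau | injectiveb w && represents a w]| = q`!.
Proof.
have -> : q`! =
    #|[set f : {ffun 'I_q -> P} in ffun_on (mem leaders) | injectiveb f]|.
  by rewrite card_inj_ffuns_on card_leaders card_ord ffactnn.
pose wf (f : {ffun 'I_q -> P}) :=
  [ffun bi : 'I_q * 'I_k => leader_step (f bi.1) bi.2].
rewrite -(@card_in_imset _ _ wf); last first.
  move=> f f'; rewrite !inE => /andP[/ffun_onP fR _] /andP[/ffun_onP fR' _] /ffunP e.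
  apply/ffunP => b; have := e (b, ord0); rewrite !ffunE /=.
  by rewrite !leader_step0.
congr #|pred_of_set _|; apply/setP => w; rewrite !inE; apply/andP/imsetP.
  move=> [/injectiveP wI rw].
  (* A preimage under [a] would give this first digit a second position [u.+1] in some row, besides
     position 0. *)
  have wR b : w (b, ord0) \in leaders.
    rewrite inE; apply/forallP => y; apply/eqP => ay.
    have [b' [u e]] := pos_exists y wI.
    have e' : pos w b' u.+1 = Some (start (w (b, ord0))).
      by rewrite -(represents_pos _ _ ak rw) SIM_expS (represents_pos _ _ ak rw) e.
    have e0 : pos w b 0 = Some (start (w (b, ord0))).
      by rewrite -[0]/(0 * k + (ord0 : 'I_k)) posE startE.
    by have [] := pos_inj wI e' e0.
  exists [ffun b => w (b, ord0)].
    rewrite !inE; apply/andP; split.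
      by apply/ffun_onP => b; rewrite ffunE.
    by apply/injectiveP => b b'; rewrite !ffunE => /wI[].
  apply/ffunP => -[b i]; rewrite !ffunE /=; apply/start_inj/Some_inj.
  by rewrite -leader_stepE //; move/forallP/(_ b)/forallP/(_ i)/eqP: rw.
move=> [f]; rewrite !inE => /andP[/ffun_onP fR /injectiveP fI] ->; split.
  apply/injectiveP => -[b i] [b' i']; rewrite !ffunE /= => e.
  have [/fI -> /val_inj -> //] :=
    leader_step_inj (fR b) (fR b') (ltn_ord i) (ltn_ord i') e.
apply/forallP => b; apply/forallP => i; rewrite !ffunE /=.
by rewrite leader_step0 // leader_stepE.
Qed.

End FixedRoot.

(** Double counting of pairs of a root and an injective tableau representing it: each root has [q!]
    tableaux, and a tableau represents one root or none according to balance. *)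
Lemma root_count_balanced :
  root_count k sigma * q`! = #|[set w : tableau | injectiveb w && balanced w]|.
Proof.
set W := [set w | _].
transitivity (\sum_(a : SIM X | (a ^+ k)%g == sigma)
                \sum_(w : tableau | injectiveb w && represents a w) 1).
  rewrite /root_count cardsE -sum_nat_const; apply: eq_bigr => a eqk.
  have ak : (a ^+ k)%g = sigma by apply/eqP.
  by rewrite -(card_representing ak) -sum1_card; apply: eq_bigl => w; rewrite inE.
rewrite (exchange_big_dep (fun w : tableau => injectiveb w)) /=; last first.
  by move=> a w _ /andP[].
rewrite -sum1_card.
rewrite [RHS](eq_bigl (fun w => injectiveb w && balanced w)) => [|w];
  last by rewrite inE.
rewrite [RHS]big_mkcondr /=; apply: eq_bigr => w wI.
have <- : nat_of_bool (balanced w) = if balanced w then 1 else 0 by case: ifP.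
rewrite -card_represented; last exact/injectiveP.
by rewrite -sum1_card; apply: eq_bigl => a; rewrite inE wI.
Qed.

End RootsOfPaths.

(** * Partitions with parts at most [k], through the frequencies of their parts *)

Section BoundedParts.
Variables (k : nat) (p : seq nat).
Hypotheses (p0 : 0 \notin p) (pk : all (leq^~ k) p).

Lemma size_bounded_parts : size p = \sum_(a < k) freq a.+1 p.
Proof.
elim: p p0 pk => [|a s IH] /=; first by rewrite big1.
rewrite inE negb_or => /andP[a0 s0] /andP[ak sk].
rewrite /freq /= big_split /= -IH // -add1n; congr (_ + _).
case: a a0 ak => // a _ ak.
rewrite (bigD1 (Ordinal ak)) //= eqxx big1 // => i.
by rewrite -val_eqE /= eqSS eq_sym => /negPf ->.
Qed.

Lemma sumn_bounded_parts : sumn p = \sum_(a < k) a.+1 * freq a.+1 p.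
Proof.
elim: p p0 pk => [|a s IH] /=; first by rewrite big1 // => i _; rewrite muln0.
rewrite inE negb_or => /andP[a0 s0] /andP[ak sk].
rewrite /freq /=; under eq_bigr do rewrite mulnDr.
rewrite big_split /= -IH //; congr (_ + _).
case: a a0 ak => // a _ ak.
rewrite (bigD1 (Ordinal ak)) //= eqxx muln1 big1 ?addn0 // => i.
by rewrite -val_eqE /= eqSS eq_sym => /negPf ->; rewrite muln0.
Qed.

(** Values up to [k] that do not occur contribute [0! = 1]. *)
Lemma prod_fact_freq :
  \prod_(a <- undup p) (freq a p)`! = \prod_(a < k) (freq a.+1 p)`!.
Proof.
rewrite -(big_mkord xpredT (fun a => (freq a.+1 p)`!)).
rewrite -(big_add1 _ _ 0 k.+1 xpredT (fun a => (freq a p)`!)).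
rewrite [RHS](bigID (mem p)) /= [X in _ * X]big1 ?muln1; last first.
  by move=> a /count_memPn; rewrite /freq => ->.
rewrite -[RHS]big_filter; apply: perm_big; apply: uniq_perm.
- exact: undup_uniq.
- by rewrite filter_uniq // iota_uniq.
move=> a; rewrite mem_undup mem_filter mem_index_iota.
have [ap|//] := boolP (a \in p); rewrite ltnS (allP pk) // andbT.
by rewrite lt0n; case: eqP ap p0 => // -> ->.
Qed.

End BoundedParts.

(** * Class patterns of a single row *)

Section RowTypes.
Variables (M k' : nat).
Local Notation k := k'.+1.

(* [Some (i, a)] is the type of a row consisting of a.+1 paths of class i
   followed by paths of class i.+1, and [None] that of a row consisting only of
   paths of the last class M. *)
Definition row_type := option ('I_M * 'I_k).

Definition row_class (y : row_type) (j : nat) : nat :=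
  if y is Some ia then (if j <= ia.2 then ia.1 : nat else ia.1.+1) else M.

Lemma row_class_ltn y j : row_class y j < M.+1.
Proof.
by case: y => //= -[i a] /=; case: ifP => _; rewrite ltnS ?(ltnW (ltn_ord i)).
Qed.

Lemma row_class_inj y y' :
  (forall j : 'I_k, row_class y j = row_class y' j) -> y = y'.
Proof.
case: y y' => [[i a]|] [[i' a']|] //= h.
- have /val_inj ei := h ord0; rewrite /= in ei; subst i'.
  congr (Some (_, _)); apply: val_inj => /=; apply/eqP.
  rewrite eqn_leq; apply/andP; split; rewrite leqNgt; apply/negP => lt.
    by have := h a; rewrite leqnn leqNgt lt => /eqP; rewrite eqn_leq ltnn andbF.
  by have := h a'; rewrite leqnn leqNgt lt => /eqP; rewrite eqn_leq ltnn.
- by have /= e := h ord0; have := ltn_ord i; rewrite e ltnn.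
by have /= e := h ord0; have := ltn_ord i'; rewrite -e ltnn.
Qed.

(** If the first entry is in class [M], the row is constant; otherwise [a] is the last column
    sharing the class of the first entry. *)
Lemma row_class_exists (c : 'I_k -> 'I_M.+1) :
    (forall i j : 'I_k, i <= j -> c i <= c j <= (c i).+1) ->
  exists y, forall j, c j = row_class y j :> nat.
Proof.
move=> h; have h0 j := h ord0 j (leq0n j).
have [c0|c0] := ltnP (c ord0) M; last first.
  exists None => j /=; apply/eqP; rewrite eqn_leq -ltnS ltn_ord /=.
  by have /andP[+ _] := h0 j; apply: leq_trans.
have [a /eqP ca amax] := @arg_maxnP _ ord0 (fun j => c j == c ord0) val (eqxx _).
exists (Some (Ordinal c0, a)) => j /=; have /andP[h1 h2] := h0 j.
case: leqP => ja.
  by have /andP[+ _] := h j a ja; rewrite ca => h3; apply/eqP; rewrite eqn_leq h1 h3.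
apply/eqP; rewrite eqn_leq h2 /= ltn_neqAle h1 andbT.
apply: contraTneq ja => e; rewrite -leqNgt; apply: amax.
by apply/eqP/val_inj; rewrite /= -e.
Qed.

Lemma row_class_monotone y i j : i <= j ->
  row_class y i <= row_class y j <= (row_class y i).+1.
Proof.
case: y => [[c a]|] /= ij; last by rewrite leqnn leqnSn.
case: (leqP i a) => ia; case: (leqP j a) => ja; rewrite ?leqnn ?leqnSn //.
by have := leq_trans ij ja; rewrite leqNgt ia.
Qed.

Lemma count_row_class (c : nat) (ia : 'I_M * 'I_k) :
  \sum_(j < k) (row_class (Some ia) j <= c) =
    if ia.1 < c then k else if ia.1 == c :> nat then ia.2.+1 else 0.
Proof.
case: ia => i a /=; case: ltngtP => ic.
- rewrite -[RHS]muln1 -[k in RHS]card_ord -sum_nat_const; apply: eq_bigr => j _.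
  by case: ifP => _; rewrite ?ic ?(ltnW ic).
- by rewrite big1 // => j _; case: ifP => _; rewrite leqNgt ?ic // ltnS ltnW.
rewrite ic -[RHS](card_ord a.+1) -sum1_card.
rewrite (big_ord_widen k (fun=> 1)) // [RHS]big_mkcond; apply: eq_bigr => j _.
by rewrite ltnS; case: ifP; rewrite ?leqnn ?ltnn.
Qed.

End RowTypes.

Arguments row_class : simpl never.

(** * Counting class patterns by tuples of partitions *)

Section Counting.
Variables (M k' q : nat) (n : nat -> nat).
Local Notation k := k'.+1.
Local Notation N := (\sum_(i < M.+1) n i).
Hypothesis NE : N = q * k.
Local Notation P := {i : 'I_M.+1 & 'I_(n i)}.
Local Notation T := (row_type M k').
Local Notation types := {ffun 'I_q -> T}.
Local Notation tableau := {ffun 'I_q * 'I_k -> P}.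
Local Notation lamT := {ffun 'I_M -> intpart_upto N}.
Implicit Types (t : types) (w : tableau) (lam : lamT).

Definition class_of t (x : 'I_q * 'I_k) : 'I_M.+1 :=
  Ordinal (row_class_ltn (t x.1) x.2).

Lemma card_tag (i : 'I_M.+1) : #|fiber (tag : P -> _) i| = n i.
Proof.
rewrite -[RHS]card_ord -cardsT.
rewrite -(@card_imset _ _ (Tagged (fun i : 'I_M.+1 => 'I_(n i)) : 'I_(n i) -> P)).
  congr #|pred_of_set _|; apply/setP => -[i' x]; rewrite inE /=.
  apply/eqP/imsetP => [e|[y _ e]]; last exact: (congr1 tag e).
  by subst i'; exists x.
by move=> x y /eqP; rewrite eq_Tagged => /eqP.
Qed.

Lemma card_P : #|{: P}| = q * k.
Proof.
rewrite -NE card_tagged sumnE big_map big_enum.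
by apply: eq_bigr => i _; rewrite card_ord.
Qed.

Definition class_balanced w : bool :=
  [forall b, forall i : 'I_k, forall j : 'I_k, (i <= j) ==>
    (tag (w (b, i)) <= tag (w (b, j)) <= (tag (w (b, i))).+1)].

(** Turns the balance condition into a sum over the patterns of row types, at most one of which fits
    a given tableau. *)
Lemma card_row_types w :
  #|[set t : types | [forall x, tag (w x) == class_of t x]]| = class_balanced w.
Proof.
have tP t : reflect (forall b (j : 'I_k), tag (w (b, j)) = row_class (t b) j :> nat)
    [forall x, tag (w x) == class_of t x].
  apply: (iffP forallP) => [h b j|h [b j]]; first by rewrite (eqP (h (b, j))).
  by apply/eqP/val_inj; rewrite /= h.
case: (boolP (class_balanced w)) => bw.
  have ex b : exists y : T, forall j, tag (w (b, j)) = row_class y j :> nat.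
    apply: (row_class_exists (c := fun j => tag (w (b, j)))) => i j ij.
    by move/forallP/(_ b)/forallP/(_ i)/forallP/(_ j)/implyP/(_ ij): bw.
  have [t0 t0P] := fin_all_exists ex.
  apply/eqP/cards1P; exists [ffun b => t0 b]; apply/setP => t; rewrite !inE.
  apply/tP/eqP => [h|-> b j]; last by rewrite ffunE.
  by apply/ffunP => b; rewrite ffunE; apply: row_class_inj => j; rewrite -h.
apply/eqP; rewrite cards_eq0; apply/eqP/setP => t; rewrite !inE.
apply: contraNF bw => /tP h; apply/forallP => b; apply/forallP => i.
apply/forallP => j; apply/implyP => ij; rewrite !h; exact: row_class_monotone.
Qed.

(** The content condition: it decides whether the pattern can be filled injectively with paths of
    the required classes. *)
Definition valid t : bool := [forall i, #|fiber (class_of t) i| == n i].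

Lemma card_class_balanced :
  #|[set w : tableau | injectiveb w && class_balanced w]|
  = #|[set t | valid t]| * \prod_(i < M.+1) (n i)`!.
Proof.
set W := [set w | _].
transitivity (\sum_(w : tableau | injectiveb w)
    \sum_(t : types | [forall x, tag (w x) == class_of t x]) 1).
  rewrite -sum1_card (eq_bigl (fun w => injectiveb w && class_balanced w)) => [|w];
    last by rewrite inE.
  rewrite big_mkcondr /=; apply: eq_bigr => w _.
  have -> : (if class_balanced w then 1 else 0) = class_balanced w by case: ifP.
  by rewrite -card_row_types -sum1_card; apply: eq_bigl => t; rewrite inE.
rewrite (exchange_big_dep xpredT) //= -sum_nat_const.
rewrite [RHS](eq_bigl valid) => [|t]; last by rewrite inE.
rewrite [RHS]big_mkcond /=; apply: eq_bigr => t _.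
transitivity #|colored_injections (class_of t) (tag : P -> _)|.
  by rewrite -sum1_card; apply: eq_bigl => w; rewrite inE.
case: ifP => [/forallP vt|vt].
  rewrite card_colored_injections => [|i]; last by rewrite (eqP (vt i)) card_tag.
  by apply: eq_bigr => i _; rewrite (eqP (vt i)).
apply/eqP; rewrite cards_eq0; apply/eqP/setP => w; rewrite [RHS]inE.
apply: contraFF vt => wC; apply/forallP => i; rewrite -card_tag; apply/eqP.
by apply: fiber_colored_injection wC _; rewrite card_P card_prod !card_ord.
Qed.

(** A part [a.+1] of [lam i] stands for a row of type [Some (i, a)]; the rows left over have type
    [None]. *)
Definition mult lam (y : T) : nat :=
  if y is Some ia then freq ia.2.+1 (lam ia.1)
  else q - \sum_(i < M) size (lam i).

Definition matches t lam : bool := [forall y, #|fiber t y| == mult lam y].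

(** [mult] sees only parts up to [k], so this bound allows [lam] to be recovered from it. *)
Definition bounded lam := forall j, all (leq^~ k) (lam j).

(** For a pattern matching a bounded [lam], the number of rows starting in a class below [j]. *)
Definition psize lam (j : nat) := \sum_(i < M | i < j) size (lam i).

Lemma psizeS lam (j : 'I_M) : psize lam j.+1 = psize lam j + size (lam j).
Proof.
rewrite /psize (bigD1 j) ?leqnn //= addnC; congr (_ + _); apply: eq_bigl => i.
by rewrite ltnS -val_eqE /= andbC -ltn_neqAle.
Qed.

Lemma psize_all lam j : M <= j -> psize lam j = \sum_(i < M) size (lam i).
Proof. by move=> Mj; apply: eq_bigl => i; rewrite (leq_trans (ltn_ord i)). Qed.

(** The conditions in [nat], freed from subtraction and division. *)
Lemma admissibleP lam :
  reflect (forall j : 'I_M,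
      [/\ sumn (lam j) + k * psize lam j = \sum_(i < j.+1) n i,
          all (leq^~ k) (lam j) &
          k * size (lam j) <= n j.+1 + sumn (lam j)])
    (@admissible k M.+1 n lam).
Proof.
have e j : [&& ((sumn (lam j))%:Z ==
          \sum_(i < M.+1 | (i <= j)%N) (n i)%:Z
          - k%:Z * \sum_(i < M | (i < j)%N) (size (lam i))%:Z)%R,
        (\max_(a <- lam j) a <= k)%N &
        ((size (lam j))%:R <= (n j.+1 + sumn (lam j))%N%:R / k%:R :> rat)%R] =
   [&& sumn (lam j) + k * psize lam j == \sum_(i < j.+1) n i,
       all (leq^~ k) (lam j) & k * size (lam j) <= n j.+1 + sumn (lam j)].
  congr [&& _, _ & _].
  - rewrite -GRing.subr_eq GRing.opprK.
    rewrite -!(big_morph Posz PoszD (erefl _)) -PoszM -PoszD eqz_nat.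
    congr (_ == _); rewrite (big_ord_widen M.+1 n) ?ltnS ?(ltnW (ltn_ord j)) //.
  - by apply/bigmax_leqP_seq/allP => h a /h; [apply | move=> + _; apply].
  rewrite Num.Theory.ler_pdivlMr ?Num.Theory.ltr0n // -GRing.natrM mulnC.
  by rewrite Num.Theory.ler_nat.
apply: (iffP forallP) => h j.
  by have := h j; rewrite e => /and3P[/eqP].
by rewrite e; have [-> -> ->] := h j; rewrite eqxx.
Qed.

Lemma zero_notin_parts lam i : 0 \notin parts (lam i).
Proof. by case: (lam i) => p /= /andP[/andP[]]. Qed.

Lemma sum_over_types t (F : T -> nat) :
  \sum_b F (t b) = \sum_y #|fiber t y| * F y.
Proof.
rewrite (partition_big t predT) //=; apply: eq_bigr => y _.
rewrite -sum_nat_const; apply: eq_big => [b|b /eqP -> //].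
by rewrite inE.
Qed.

Lemma big_row_type (R : Type) (idx : R) (op : Monoid.com_law idx) (F : T -> R) :
  \big[op/idx]_y F y =
  op (F None) (\big[op/idx]_(i < M) \big[op/idx]_(a < k) F (Some (i, a))).
Proof.
rewrite (bigD1 None) //=; congr (op _ _).
rewrite pair_big /= (reindex_omap Some id) /=; last by case.
by apply: eq_big => [[i a]|[i a] _] //=; rewrite eqxx.
Qed.

(** Count the entries of class at most [j] by rows: a row starting in an earlier class has all [k]
    of its entries there, a row starting in class [j] contributes its part of [lam j], and the other
    rows contribute nothing. *)
Lemma matches_sum t lam (j : 'I_M) : bounded lam -> matches t lam ->
  \sum_(i < M.+1 | i <= j) #|fiber (class_of t) i|
  = sumn (lam j) + k * psize lam j.
Proof.
move=> lk /forallP mt.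
transitivity (\sum_b \sum_(x < k) (row_class (t b) x <= j)).
  rewrite pair_big /=.
  transitivity (\sum_(x | class_of t x <= j) 1); last first.
    by rewrite big_mkcond; apply: eq_bigr => x _ /=; case: ifP.
  rewrite (partition_big (class_of t) (fun i : 'I_M.+1 => i <= j)) //=.
  apply: eq_bigr => i ij; rewrite -sum1_card; apply: eq_bigl => x.
  by rewrite inE andb_idl // => /eqP e; rewrite -e in ij.
rewrite (sum_over_types t (fun y => \sum_(x < k) (row_class y x <= j))).
rewrite big_row_type /= [X in _ * X]big1 ?muln0 ?add0n; last first.
  by move=> x _; rewrite /row_class leqNgt ltn_ord.
rewrite (bigID (fun i : 'I_M => i < j)) /= addnC; congr (_ + _).
  rewrite (bigD1 j) ?ltnn //= [X in _ + X]big1 ?addn0; last first.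
    move=> i; rewrite -leqNgt => /andP[ji nij]; rewrite big1 // => a _.
    rewrite count_row_class /= ltnNge ji /=.
    by rewrite val_eqE (negPf nij) muln0.
  rewrite (sumn_bounded_parts (zero_notin_parts lam j) (lk j)); apply: eq_bigr => a _.
  by rewrite (eqP (mt _)) count_row_class /= ltnn eqxx mulnC.
rewrite /psize big_distrr /=; apply: eq_bigr => i ij.
rewrite (size_bounded_parts (zero_notin_parts lam i) (lk i)) big_distrr /=.
by apply: eq_bigr => a _; rewrite (eqP (mt _)) count_row_class /= ij mulnC.
Qed.

Lemma sum_classes t : \sum_(i < M.+1) #|fiber (class_of t) i| = N.
Proof. by rewrite sum_fiber NE card_prod !card_ord. Qed.

Lemma sum_le_ord (f : nat -> nat) (j : nat) : j <= M ->
  \sum_(i < M.+1 | i <= j) f i = \sum_(i < j.+1) f i.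
Proof. by move=> jM; rewrite (big_ord_widen M.+1 f). Qed.

Lemma matches_size lam t : bounded lam -> matches t lam ->
  \sum_(i < M) size (lam i) + #|fiber t None| = q.
Proof.
move=> lk /forallP mt; have := sum_fiber t; rewrite card_ord big_row_type => e.
rewrite -[RHS]e addnC /=; congr (_ + _); apply: eq_bigr => i _.
rewrite (size_bounded_parts (zero_notin_parts lam i) (lk i)); apply: eq_bigr => a _.
by rewrite (eqP (mt _)).
Qed.

Lemma admissible_bounded lam : @admissible k M.+1 n lam -> bounded lam.
Proof. by move=> /admissibleP h j; have [] := h j. Qed.

(** The sum condition and the size bound at the last index [M.-1] together give
    [k * psize lam M <= N], and [N] is [q * k]. *)
Lemma admissible_size lam : @admissible k M.+1 n lam ->
  \sum_(i < M) size (lam i) <= q.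
Proof.
move=> /admissibleP h; case: (posnP M) => [M0|M0].
  by rewrite big1 // => i; have := ltn_ord i; rewrite [X in _ < X]M0.
have lM : M.-1 < M by rewrite prednK.
have [e1 _ e3] := h (Ordinal lM).
rewrite -(@leq_pmul2l k) // -(@psize_all _ M) //.
have -> : k * q = \sum_(i < M) n i + n M by rewrite mulnC -NE big_ord_recr.
rewrite -{1}(prednK M0) (psizeS lam (Ordinal lM)) mulnDr.
move: e1 e3 => /=; rewrite prednK // => <- e3.
by rewrite addnC addnAC leq_add2r addnC.
Qed.

Lemma prefix_sums_inj (f g : nat -> nat) m :
    (forall j, j < m -> \sum_(i < j.+1) f i = \sum_(i < j.+1) g i) ->
  forall i, i < m -> f i = g i.
Proof.
move=> h i im; have := h i im; rewrite !big_ord_recr /=.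
suff -> : \sum_(j < i) f j = \sum_(j < i) g j by move/addnI.
case: i im => [|i] im; first by rewrite !big_ord0.
by apply: h; apply: ltnW.
Qed.

(** The sum conditions fix all prefix sums of the content except the last, which is the total number
    [N] of entries. *)
Lemma admissible_valid t lam : @admissible k M.+1 n lam -> matches t lam ->
  valid t.
Proof.
move=> alam mt; have lk := admissible_bounded alam; apply/forallP => i.
pose f (i : nat) := #|fiber (class_of t) (inord i)|.
have fE (j : 'I_M.+1) : f j = #|fiber (class_of t) j| by rewrite /f inord_val.
rewrite -fE; apply/eqP.
apply: (@prefix_sums_inj f n M.+1) (ltn_ord i) => j jM; rewrite ltnS in jM.
rewrite -sum_le_ord //; under eq_bigr do rewrite fE.
have [jM'|Mj] := ltnP j M.
  rewrite (matches_sum (Ordinal jM') lk mt).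
  by have [] := admissibleP _ alam (Ordinal jM').
have -> : j = M by apply/eqP; rewrite eqn_leq jM.
rewrite -(sum_classes t); apply: eq_bigl => l.
by rewrite -ltnS ltn_ord.
Qed.

(** Given the sum conditions, the bound on [size (lam j)] means that [k * psize lam j.+1] is at most
    the number of paths of classes up to [j.+1]. This follows from the sum condition at [j.+1] or,
    at the last index, from there being only [q] rows. *)
Lemma valid_admissible t lam : bounded lam -> matches t lam -> valid t ->
  @admissible k M.+1 n lam.
Proof.
move=> lk mt /forallP vt.
have e1 (j : 'I_M) : sumn (lam j) + k * psize lam j = \sum_(i < j.+1) n i.
  rewrite -(matches_sum _ lk mt) -sum_le_ord ?(ltnW (ltn_ord j)) //.
  by apply: eq_bigr => i _; rewrite (eqP (vt i)).
apply/admissibleP => j; split=> //.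
suff le : k * psize lam j.+1 <= \sum_(i < j.+2) n i.
  move: le; rewrite psizeS mulnDr [X in _ <= X -> _]big_ord_recr /= -e1.
  by rewrite addnC addnAC leq_add2r addnC.
have [jM|Mj] := ltnP j.+1 M; first by rewrite -(e1 (Ordinal jM)) leq_addl.
rewrite psize_all //.
have -> : \sum_(i < j.+2) n i = k * q.
  have -> : j.+1 = M by apply/eqP; rewrite eqn_leq ltn_ord.
  by rewrite NE mulnC.
by rewrite leq_mul2l /= -[q in X in _ <= X](matches_size lk mt) leq_addr.
Qed.

Lemma matches_inj t lam lam' : bounded lam -> bounded lam' ->
  matches t lam -> matches t lam' -> lam = lam'.
Proof.
move=> lk lk' /forallP mt /forallP mt'; apply/ffunP => i; apply: val_inj.
apply: (@sorted_eq _ geq).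
- by move=> x y z /= h1 h2; apply: leq_trans h2 h1.
- by move=> x y; rewrite andbC -eqn_leq => /eqP.
- by case: (lam i) => p /= /andP[/andP[]].
- by case: (lam' i) => p /= /andP[/andP[]].
apply/allP => x _ /=; apply/eqP.
(* It remains to compare frequencies; 0 and values above [k] occur in neither partition. *)
have out l : bounded l -> (x == 0) || (k < x) -> count_mem x (parts (l i)) = 0.
  move=> lb hx; apply/count_memPn; apply/negP => xp; case/orP: hx => [/eqP x0|].
    by have /negP := zero_notin_parts l i; apply; rewrite x0 in xp.
  by rewrite ltnNge (allP (lb i)).
have [hx|] := boolP ((x == 0) || (k < x)); first by rewrite !out.
case: x {out} => // x; rewrite -leqNgt => xk.
have := mt (Some (i, Ordinal xk)); have := mt' (Some (i, Ordinal xk)).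
by move=> /eqP -> /eqP /esym.
Qed.

Lemma matches_exists t : exists2 lam, bounded lam & matches t lam.
Proof.
pose ps i := sort geq (flatten [seq nseq #|fiber t (Some (i, a))| (a : nat).+1
                               | a <- enum 'I_k]).
have psP i x : x \in ps i -> 0 < x <= k.
  by rewrite mem_sort => /flatten_mapP[a _ /nseqP[-> _]] /=.
have ps0 i : 0 \notin ps i by apply/negP => /psP.
have psk i : all (leq^~ k) (ps i) by apply/allP => x /psP/andP[].
have psC i (a : 'I_k) : freq a.+1 (ps i) = #|fiber t (Some (i, a))|.
  rewrite /freq (seq.permP (permEl (perm_sort _ _))) count_flatten -map_comp.
  rewrite sumnE big_map big_enum (bigD1 a) //= count_nseq /= eqxx mul1n.
  rewrite big1 ?addn0 // => j ja; rewrite count_nseq /= eqSS.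
  by rewrite val_eqE (negPf ja).
have st : \sum_(i < M) \sum_(a < k) #|fiber t (Some (i, a))| + #|fiber t None| = q.
  by have := sum_fiber t; rewrite card_ord big_row_type addnC.
have ex i : exists p : intpart_upto N, parts p = ps i.
  have pP : is_intpart (ps i) && (sumn (ps i) <= N).
    rewrite /is_intpart ps0 sort_sorted ?andTb; last by move=> x y; apply: leq_total.
    (* The bound [N] in the type is respected: at most [q] rows start in class [i], and each
       contributes a part of at most [k]. *)
    rewrite NE mulnC (sumn_bounded_parts (ps0 i) (psk i)) -[q]st.
    apply: (@leq_trans (k * \sum_(a < k) #|fiber t (Some (i, a))|)).
      by rewrite big_distrr /=; apply: leq_sum => a _; rewrite psC leq_mul.
    by rewrite leq_mul2l (bigD1 i) //= -addnA leq_addr.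
  by exists (MkIntpart pP).
have [l lE] := fin_all_exists ex.
exists [ffun i => l i]; first by move=> i; rewrite ffunE lE.
apply/forallP => -[[i a]|] /=; first by rewrite ffunE lE psC.
rewrite -[q in X in _ == X]st.
have -> : \sum_(i < M) size ([ffun i => l i] i) =
    \sum_(i < M) \sum_(a < k) #|fiber t (Some (i, a))|.
  apply: eq_bigr => i _; rewrite ffunE lE (size_bounded_parts (ps0 i) (psk i)).
  by apply: eq_bigr => a _.
by rewrite addKn.
Qed.

(** A valid pattern matches exactly one admissible tuple, and every pattern matching an admissible
    tuple is valid. *)
Lemma card_valid :
  #|[set t | valid t]| =
  \sum_(lam : lamT | @admissible k M.+1 n lam) #|[set t | matches t lam]|.
Proof.
transitivity (\sum_(t | valid t)
  \sum_(lam : lamT | @admissible k M.+1 n lam && matches t lam) 1).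
  rewrite cardsE -sum1_card; apply: eq_bigr => t vt; rewrite sum1_card.
  have [lam lk mt] := matches_exists t.
  apply/esym/eqP/fintype.card1P; exists lam => lam'; rewrite !inE unfold_in.
  apply/andP/eqP => [[alam' mt']|->]; last by split=> //; exact: valid_admissible vt.
  exact: matches_inj (admissible_bounded alam') lk mt' mt.
rewrite (exchange_big_dep (fun lam => @admissible k M.+1 n lam)) /=; last first.
  by move=> t lam _ /andP[].
apply: eq_bigr => lam alam; rewrite -sum1_card; apply: eq_bigl => t.
rewrite inE alam /= andb_idl //; exact: admissible_valid.
Qed.

(** The multinomial count [card_fiber_sizes] with the row types as letters and [mult lam] as
    multiplicities. *)
Lemma card_matches lam : @admissible k M.+1 n lam ->
  #|[set t | matches t lam]| *
    ((q - \sum_(i < M) size (lam i))`! *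
     \prod_(i < M) \prod_(a <- undup (lam i)) (freq a (lam i))`!) = q`!.
Proof.
move=> alam; have lk := admissible_bounded alam.
rewrite -(@card_fiber_sizes _ (mult lam) q) ?big_row_type /=.
  congr (_ * (_ * _)); apply: eq_bigr => i _.
  by rewrite (prod_fact_freq (zero_notin_parts lam i) (lk i)).
rewrite -[RHS](subnK (admissible_size alam)); congr (_ + _).
apply: eq_bigr => i _.
by rewrite (size_bounded_parts (zero_notin_parts lam i) (lk i)).
Qed.

End Counting.

(** * From path lengths to classes, and the resulting formula *)

Import Order.TTheory GRing.Theory Num.Theory.
Local Open Scope ring_scope.

Lemma perm_allpairs_tagged (m : nat) (n : nat -> nat) :
  perm_eq [seq @Tagged 'I_m i (fun i => 'I_(n i)) j
            | i <- enum 'I_m, j <- enum 'I_(n i)]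
    (enum {: {i : 'I_m & 'I_(n i)}}).
Proof.
apply: uniq_perm; rewrite ?enum_uniq //.
  apply: allpairs_uniq_dep => [|i _|]; rewrite ?enum_uniq //.
  by move=> [i j] [i' j'] _ _.
move=> [i j]; rewrite mem_enum inE; apply/allpairsPdep.
by exists i, j; rewrite !mem_enum.
Qed.

Theorem theorem3 (X : finType) (sigma : SIM X) (k m : nat) (n : nat -> nat)
    (s : forall i : 'I_m, 'I_(n i) -> seq X) (L : int)
    (hk : (0 < k)%N) (hm : (2 <= m)%N)
    (hn : forall i : 'I_m, (0 < n i)%N)
    (hkn : (k %| \sum_(i < m) n i)%N)
    (hdec : decomposition sigma
              [seq Path (s i j) | i <- enum 'I_m, j <- enum 'I_(n i)])
    (hL : forall (i : 'I_m) (j : 'I_(n i)), (size (s i j))%:Z = L - i%:Z)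
    (hsize : forall (i : 'I_m) (j : 'I_(n i)), (2 <= size (s i j))%N) :
  (root_count k sigma)%:R
  = \sum_(lam : {ffun 'I_m.-1 -> intpart_upto (\sum_(i < m) n i)}
          | admissible k lam) root_term k lam :> rat.
Proof.
case: m => [|M] // in s hm hn hkn hdec hL hsize *.
case: k => [|k'] // in hk hkn *.
pose P := {i : 'I_M.+1 & 'I_(n i)}.
pose S (p : P) := s (tag p) (tagged p).
pose q := ((\sum_(i < M.+1) n i) %/ k'.+1)%N.
have NE : (\sum_(i < M.+1) n i = q * k'.+1)%N by rewrite divnK.
have allE : [seq Path (s i j) | i <- enum 'I_M.+1, j <- enum 'I_(n i)] =
    [seq Path (S p) | p <- [seq @Tagged 'I_M.+1 i (fun i => 'I_(n i)) j
                             | i <- enum 'I_M.+1, j <- enum 'I_(n i)]].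
  by rewrite map_allpairs.
have [_ hdig hval] := hdec; rewrite allE in hdig hval.
have digitsS : perm_eq (flatten [seq S p | p <- enum {: P}]) (enum X).
  apply: perm_trans hdig; rewrite -map_comp perm_flatten //.
  by apply: perm_map; rewrite perm_sym perm_allpairs_tagged.
have sizeS p : (1 < size (S p))%N by exact: hsize.
have sigmaS p x : x \in S p -> sigma x = onth (S p) (index x (S p)).+1.
  move=> xp; apply: (hval (Path (S p))) => //; apply: map_f.
  by rewrite (perm_mem (perm_allpairs_tagged _ _)) mem_enum.
have cP : #|{: P}| = (q * k'.+1)%N by exact: card_P.
(* Length plus class is the constant [L], so the inequalities between lengths become reversed
   inequalities between classes, and [balanced] becomes [class_balanced]. *)
have sumS p p' : (size (S p) + tag p = size (S p') + tag p')%N.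
  apply/eqP; rewrite -eqz_nat !PoszD /S !hL; apply/eqP.
  by rewrite !subrK.
have := root_count_balanced digitsS sizeS sigmaS cP.
rewrite (_ : [set w | _] = [set w : {ffun 'I_q * 'I_k'.+1 -> P}
                             | injectiveb w && class_balanced w]); last first.
  apply/setP => w; rewrite !inE; congr (_ && _).
  apply: eq_forallb => b; apply: eq_forallb => i; apply: eq_forallb => j.
  congr (_ ==> (_ && _)).
    rewrite -(leq_add2r (tag (w (b, j)))) (sumS _ (w (b, i))).
    by rewrite leq_add2l.
  rewrite -(leq_add2r (tag (w (b, i)))) (sumS (w (b, i)) (w (b, j))).
  by rewrite addSnnS leq_add2l.
rewrite card_class_balanced // card_valid // => /(congr1 (fun x => x%:R : rat)).
rewrite !natrM natr_sum => e.
(* Both sides are compared after multiplication by [q!], the number of orderings of the rows, which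
   [card_matches] factors in each summand. *)
have q0 : (q`!)%:R != 0 :> rat by rewrite pnatr_eq0 -lt0n fact_gt0.
apply: (mulIf q0); rewrite e !mulr_suml; apply: eq_bigr => lam alam.
rewrite /root_term -/q -(card_matches NE alam) [X in _ = _ * X]natrM.
rewrite mulrC -mulrA; congr (_ * _); rewrite mulrCA mulVf ?mulr1 //.
rewrite pnatr_eq0 -lt0n muln_gt0 fact_gt0 /=.
by rewrite prodn_gt0 // => i; rewrite prodn_gt0 // => a; rewrite fact_gt0.
Qed.
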